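(* Let $X$ be a topological space and $x \in X$. Then $X$ is radial at $x$ if and only if for every cofinal collection $\mathcal{C} \subseteq \mathbf{Sp}(x,X)$ of spokes at $x$, the union $\bigcup \mathcal{C}$ is a neighbourhood of $x$.
   Context: No separation axioms are assumed. A transfinite sequence is a net whose domain is (nonempty and) well-ordered. $X$ is radial at $x$ if for every $A \subseteq X$ with $x \in \overline{A}$ there is a transfinite sequence with range in $A$ converging to $x$. A space is well-based at a point if that point has a neighbourhood base (neighbourhoods need not be open) well-ordered by $\supseteq$. A spoke at $x$ in $X$ is a subspace $S$ of $X$ with $x \in S$ such that $S$ is well-based at $x$; $\mathbf{Sp}(x,X)$ is the set of all spokes at $x$. For $A,B\subseteq X$, write $A \subseteq_x B$ if there is a neighbourhood $U$ of $x$ with $A \cap U \subseteq B$. $\mathbf{Sp}(x,X)$ is quasi-ordered by $\subseteq_x$; $\mathcal{C} \subseteq \mathbf{Sp}(x,X)$ is cofinal if for every $S \in \mathbf{Sp}(x,X)$ there is $C \in \mathcal{C}$ with $S \subseteq_x C$. *)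

(* Defs.v *)
From HB Require Import structures.
From mathcomp Require Import all_boot all_classical.
From mathcomp Require Import topology.
From mathcomp Require wochoice.

Set Implicit Arguments.
Unset Strict Implicit.
Unset Printing Implicit Defensive.

Local Open Scope classical_set_scope.

Definition tail_filter (I : Type) (R : rel I) : set_system I :=
  filter_from setT (fun i : I => [set j | R i j]).

(* [wochoice.well_order R] (every nonempty subset has a unique minimum) makes
   [R] a reflexive well-order on [I], with [R i j] read as "i <= j". *)
Definition radial_at (X : topologicalType) (x : X) : Prop :=
  forall A : set X, closure A x ->
    exists (I : Type) (R : rel I) (f : I -> X),
      [/\ inhabited I, wochoice.well_order R,
          forall i, A (f i) & f @ tail_filter R --> x].

Definition nbhs_base (T : topologicalType) (x : T) (B : set_system T) : Prop :=
  B `<=` nbhs x /\ forall U, nbhs x U -> exists2 V, B V & V `<=` U.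

Definition supset_rel (T : Type) : rel (set T) := fun U V => `[< V `<=` U >].

Definition well_based_at (T : topologicalType) (x : T) : Prop :=
  exists2 B : set_system T,
    nbhs_base x B & wochoice.wo_chain (@supset_rel T) (mem B).

(* The subtype [set_type S] carries the subspace topology; [exist _ x Sx] is
   the point [x] of that subspace. *)
Definition spokes (X : topologicalType) (x : X) : set (set X) :=
  [set S | exists Sx : x \in S,
     @well_based_at (set_type S) (exist _ x Sx)].

Definition subset_near (X : topologicalType) (x : X) (A B : set X) : Prop :=
  exists2 U, nbhs x U & A `&` U `<=` B.

Definition cofinal_spokes (X : topologicalType) (x : X) (C : set (set X)) :
    Prop :=
  C `<=` spokes x /\
  forall S, spokes x S -> exists2 D, C D & subset_near x S D.

(* Main.v *)
(** Two ideas give the theorem.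

    If [x] is in the closure of [S `&` A] for a spoke [S], choosing a point of
    [A] in each member of a well-ordered base at [x] of [S] gives a transfinite
    sequence in [A] converging to [x].  So if no such sequence exists, the
    spokes disjoint from [A] are cofinal ([S] is dominated by [S `\` A]), their
    union is a neighbourhood of [x], and [x] is not in the closure of [A].

    Conversely, if [X] is radial at [x] and [x] is in the closure of [A], there
    is a spoke [S] with [x] in the closure of [S `&` A].  Take a family [h] in
    [A], indexed by a well-order [J] of least possible order type, with [x] in
    the closure of its range, and a transfinite sequence [f] in the range of
    [h] converging to [x].  By minimality, [f] eventually leaves
    [h @` {k < j}] for each [j]; let [g j] be the value of [f] from the first
    index on which this happens.  Then [g] converges to [x] along [J], and again
    by minimality, removing [g @` {k < j}] from the range of [g] leaves a
    neighbourhood of [x]; these neighbourhoods form a well-ordered base. *)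

Require Import Defs.
From mathcomp Require Import all_boot all_classical.
From mathcomp Require Import topology.
From mathcomp Require wochoice.

Set Implicit Arguments.
Unset Strict Implicit.
Unset Printing Implicit Defensive.

Local Open Scope classical_set_scope.

Lemma wo_chain_minimum (T : Type) (R : rel T) (C D : set T) :
  wochoice.wo_chain R (mem C) -> D `<=` C -> D !=set0 ->
  exists2 m, D m & forall n, D n -> R m n.
Proof.
move=> woC DC [d Dd].
have [|m [[mD lbm] _]] := woC (mem D) _ (ex_intro _ d (mem_set Dd)).
  by move=> y; rewrite !inE; exact: DC.
exists m; first by rewrite inE in mD.
by move=> n Dn; apply: lbm; rewrite inE.
Qed.

Lemma well_order_minimum (T : Type) (R : rel T) (D : set T) :
  wochoice.well_order R -> D !=set0 ->
  exists2 m, D m & forall n, D n -> R m n.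
Proof.
move=> woR; apply: (@wo_chain_minimum _ _ setT) => //.
by move=> A _; exact: woR.
Qed.

(** Minima of pairs give totality, hence reflexivity; uniqueness of the minimum of a pair gives
    antisymmetry; minima of triples give transitivity. *)
Lemma well_order_total_order (T : Type) (R : rel T) :
  wochoice.well_order R -> wochoice.total_order R.
Proof.
move=> woR.
have tot : total R.
  move=> a b.
  have [|m [->|->] lbm] := @well_order_minimum _ _ [set a; b] woR.
  - by exists a; left.
  - by rewrite lbm //; right.
  - by rewrite orbC lbm //; left.
have refl : reflexive R by move=> a; have := tot a a; rewrite orbb.
have anti : antisymmetric R.
  move=> a b /andP[Rab Rba].
  have [|m [_ m_uniq]] := woR (mem [set a; b]).
    by exists a; rewrite inE; left.
  apply: (etrans (esym (m_uniq a _)) (m_uniq b _)); split.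
  - by rewrite inE; left.
  - by move=> c; rewrite inE => -[] ->.
  - by rewrite inE; right.
  - by move=> c; rewrite inE => -[] ->.
split=> //; split=> //; split=> // b a c Rab Rbc.
have [|m mabc lbm] := @well_order_minimum _ _ [set a; b; c] woR.
  by exists a; left; left.
have [ma mb mc] : [/\ R m a, R m b & R m c].
  by split; apply: lbm; [left; left|left; right|right].
case: mabc ma mb mc => [[]|] -> // ma mb mc.
  by have -> : a = b by apply: anti; rewrite Rab.
by have <- : b = c by apply: anti; rewrite Rbc.
Qed.

(** [F] may identify elements, so a family of images is pulled back to [C] and the minimum is taken
    there. Its image is the unique minimum because inclusion is antisymmetric. *)
Lemma wo_chain_supset_image (T U : Type) (R : rel T) (C : set T)
    (F : T -> set U) :
  wochoice.wo_chain R (mem C) ->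
  (forall a b, C a -> C b -> R a b -> F b `<=` F a) ->
  wochoice.wo_chain (@supset_rel U) (mem (F @` C)).
Proof.
move=> woC Fanti; apply: wochoice.antisymmetric_wo_chain.
  by move=> A B _ _ /andP[/asboolP BA /asboolP AB]; exact/seteqP.
move=> D DF [A AD].
have [||m [Cm Dm] lbm] := @wo_chain_minimum _ _ _ (C `&` F @^-1` [set B | B \in D]) woC.
- by move=> a [].
- by have := DF _ AD; rewrite inE => -[a Ca FaA]; exists a; rewrite /= FaA.
exists (F m); split=> // B BD; apply/asboolP.
have := DF _ BD; rewrite inE => -[b Cb FbB]; rewrite -FbB.
by apply: Fanti => //; apply: lbm; split; rewrite //= FbB.
Qed.

Lemma nbhs_set_typeE (X : topologicalType) (S : set X) (y : set_type S)
    (U : set (set_type S)) :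
  nbhs y U <-> within S (nbhs (val y)) (val @` U).
Proof.
split.
  case=> _ [[O oO <-] Oy OU].
  rewrite /within /=; apply: filterS (open_nbhs_nbhs (conj oO Oy)) => z Oz Sz.
  by exists (exist _ z (mem_set Sz)) => //; exact: OU.
rewrite /within /= nbhsE => -[O [oO Oy] OU].
exists (set_val @^-1` O); split => //; first by exists O.
move=> z Oz; have [z' Uz' /val_inj <- //] := OU _ Oz (set_valP z).
Qed.

(** Images and preimages under [val] carry a base of the subspace to sets of [X] and back. Members
    of [B] may stick out of [S], so the same [B] serves every smaller spoke. *)
Lemma spokesP (X : topologicalType) (x : X) (S : set X) :
  spokes x S <->
  S x /\ exists2 B : set_system X,
    B `<=` within S (nbhs x) /\
      (forall V, nbhs x V -> exists2 b, B b & S `&` b `<=` V)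
    & wochoice.wo_chain (@supset_rel X) (mem B).
Proof.
split.
  case=> Sx [B [Bnbhs Bbase] woB]; split; first by move: (Sx); rewrite inE.
  exists ((fun b => val @` b) @` B); last first.
    apply: wo_chain_supset_image woB _ => a b _ _ /asboolP ba.
    exact: image_subset.
  split; first by move=> _ [b /Bnbhs /nbhs_set_typeE ? <-].
  move=> V xV; have [|b Bb bV] := Bbase (val @^-1` V).
    apply/nbhs_set_typeE; rewrite /within /=.
    by apply: filterS xV => z Vz Sz; exists (exist _ z (mem_set Sz)).
  by exists (val @` b); [exists b|move=> _ [_ [z /bV Vz <-]]].
case=> Sx [B [Bnbhs Bbase] woB]; exists (mem_set Sx).
exists ((fun b => val @^-1` b) @` B); last first.
  apply: wo_chain_supset_image woB _ => a b _ _ /asboolP ba.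
  exact: preimage_subset.
split.
  move=> _ [b /Bnbhs xb <-]; apply/nbhs_set_typeE.
  rewrite /within /= in xb *; apply: filterS xb => z bz Sz.
  by exists (exist _ z (mem_set Sz)) => //; exact: bz.
move=> U /nbhs_set_typeE /Bbase[b Bb bU]; exists (val @^-1` b); first by exists b.
move=> z bz; have Sz := set_valP z.
by have [z' Uz' /val_inj <-] := bU _ (conj Sz bz) Sz.
Qed.

Lemma spokes_subset (X : topologicalType) (x : X) (S D : set X) :
  D `<=` S -> D x -> spokes x S -> spokes x D.
Proof.
move=> DS Dx /spokesP[_ [B [Bnbhs Bbase] woB]]; apply/spokesP; split=> //.
exists B => //; split=> [b /Bnbhs|V /Bbase[b Bb bV]].
  by rewrite /within /= => xb; apply: filterS xb => z zb /DS; exact: zb.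
by exists b => // z [/DS Sz bz]; exact: bV.
Qed.

Definition transfinite_cvg (X : topologicalType) (A : set X) (x : X) : Prop :=
  exists (I : Type) (R : rel I) (f : I -> X),
    [/\ inhabited I, wochoice.well_order R,
        forall i, A (f i) & f @ tail_filter R --> x].

Lemma spoke_transfinite_cvg (X : topologicalType) (x : X) (S A : set X) :
  spokes x S -> closure (S `&` A) x -> transfinite_cvg A x.
Proof.
move=> /spokesP[_ [B [Bnbhs Bbase] woB]] clx.
(* Outside [B] the choice is vacuous and [x] is a dummy value. *)
have pick b : exists y, B b -> S y /\ A y /\ b y.
  have [Bb|nBb] := pselect (B b); last by exists x.
  by have [y [[Sy Ay] /(_ Sy) by_]] := clx _ (Bnbhs _ Bb); exists y.
have [f fP] := choice pick.
exists {b | B b}, (fun b c => supset_rel (sval b) (sval c)), (fun b => f (sval b)).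
split.
- by have [b Bb _] := Bbase _ (filterT : nbhs x setT); constructor; exists b.
- apply: wochoice.antisymmetric_well_order.
    move=> [a Ba] [b Bb] /= /andP[/asboolP ba /asboolP ab].
    by apply: eq_exist => /=; exact/seteqP.
  move=> D [b Db].
  have [||m [Bm Dm] lbm] := @wo_chain_minimum _ _ _
      [set a | exists Ba : B a, exist _ a Ba \in D] woB.
  + by move=> a [].
  + by exists (sval b); case: b Db => b Bb /=; exists Bb.
  by exists (exist _ m Bm); split=> // -[c Bc] Dc; apply: lbm; exists Bc.
- by case=> b Bb; have [_ []] := fP _ Bb.
move=> V /Bbase[b Bb bV]; exists (exist _ b Bb) => //.
move=> [c Bc] /= /asboolP cb; have [Sf [_ cf]] := fP _ Bc.
by apply: bV; split=> //; exact: cb.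
Qed.

(* [R] is a well-order of all of [X]; well-orders embeddable in [X] are, up to
   isomorphism, its initial segments [J]. *)
Lemma minimal_closure_family (X : topologicalType) (x : X) (A : set X) :
  closure A x ->
  exists (R : rel X) (J : set X) (h : X -> X),
    [/\ wochoice.well_order R, h @` J `<=` A, closure (h @` J) x &
        forall (j : X) (g : X -> X), J j ->
          g @` [set k | J k /\ ~~ R j k] `<=` A ->
          ~ closure (g @` [set k | J k /\ ~~ R j k]) x].
Proof.
move=> clA; have [R woR] := @wochoice.well_ordering_principle X.
have [[[_ trans] _] tot] := well_order_total_order woR.
pose P d := exists h : X -> X, h @` [set k | ~~ R d k] `<=` A /\
  closure (h @` [set k | ~~ R d k]) x.
(* [d] is the least element whose strict initial segment indexes a family in [A] with [x] in the
   closure of its range. *)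
have [/(well_order_minimum woR)[d [h [hA clh]] lbd]|noP] := pselect (P !=set0).
  exists R, [set k | ~~ R d k], h; split=> // j g /= ndj.
  have -> : [set k | ~~ R d k /\ ~~ R j k] = [set k | ~~ R j k].
    apply/seteqP; split=> k /=; first by case.
    move=> njk; split=> //; apply: contra njk => Rdk.
    by apply: trans Rdk; have := tot d j; rewrite (negbTE ndj).
  by move=> gA clg; move: ndj; rewrite lbd //; exists g.
(* No strict initial segment suffices, so [J] is all of [X], and [h] is the identity on [A] with the
   default value [a] elsewhere. *)
have [a [Aa _]] := clA _ (filterT : nbhs x setT).
exists R, setT, (fun y => if y \in A then y else a); split=> //.
- by move=> _ [y _ <-]; case: ifPn => //; rewrite inE.
- apply: closureS clA => y Ay; exists y => //.
  by rewrite mem_set.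
move=> j g _.
have -> : [set k | setT k /\ ~~ R j k] = [set k | ~~ R j k].
  by apply/seteqP; split=> k // [].
by move=> gA clg; apply: noP; exists j, g.
Qed.

Lemma nbhs_notin_closure (X : topologicalType) (x : X) (A : set X) :
  ~ closure A x -> nbhs x (~` A).
Proof. by rewrite -[~ _]/((~` closure A) x) -interiorC. Qed.

Lemma radial_spoke (X : topologicalType) (x : X) (A : set X) :
  radial_at x -> closure A x ->
  exists2 S, spokes x S & closure (S `&` A) x.
Proof.
move=> radx /minimal_closure_family[R [J [h [woR hA clh minJ]]]].
have [[[_ trans] anti] tot] := well_order_total_order woR.
have [I [Q [f [[i0] woQ fh cvgf]]]] := radx _ clh.
have [[[Qrefl Qtrans] _] Qtot] := well_order_total_order woQ.
pose below j := [set k | J k /\ ~~ R j k].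
pose leaves j i := forall k, Q i k -> ~ (h @` below j) (f k).
have pick j : exists i,
    J j -> leaves j i /\ forall k, leaves j k -> Q i k.
  have [Jj|nJj] := pselect (J j); last by exists i0.
  have clj : ~ closure (h @` below j) x.
    by apply: minJ => // _ [k [Jk _] <-]; apply: hA; exists k.
  have [i _ fi] := cvgf _ (nbhs_notin_closure clj).
  have [|m] := @well_order_minimum _ _ (leaves j) woQ; last by exists m.
  by exists i => k; exact: fi.
have [s sP] := choice pick.
pose g j := f (s j).
have gA : g @` J `<=` A by move=> _ [j Jj <-]; exact/hA/fh.
have g_notin j : J j -> exists2 k, J k /\ R j k & g j = h k.
  move=> Jj; have [k Jk hk] := fh (s j); exists k => //; split=> //.
  apply/negPn/negP => njk; have [/(_ (s j) (Qrefl _)) sj _] := sP _ Jj.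
  by apply: sj; exists k.
have J0 : J !=set0 by have [_ [[j Jj _] _]] := clh _ (filterT : nbhs x setT); exists j.
have cvgg V : nbhs x V -> exists2 j, J j & forall k, J k -> R j k -> V (g k).
  move=> /cvgf[i _ fV].
  (* If some [s j] is at or after [i], so is [s k] for every [k] above [j]: leaving the image of
     [below k] entails leaving that of [below j], so [s] is monotone on [J]. *)
  have [[j [Jj Qij]]|nocof] := pselect (exists j, J j /\ Q i (s j)).
    exists j => // k Jk Rjk; apply: fV => /=; apply: Qtrans Qij _.
    have [_] := sP _ Jj; apply=> l Qkl [p [Jp njp] hp].
    have [/(_ l Qkl) + _] := sP _ Jk; apply; exists p => //; split=> //.
    by apply: contra njp; exact: trans.
  (* The indices [s j] are bounded by [i], so [f i] lies above every [j]: it is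
     [h m] for the maximum [m] of [J]. *)
  have [m Jm hm] := fh i.
  have mmax j : J j -> R j m.
    move=> Jj; apply/negPn/negP => njm; have [/(_ i) + _] := sP _ Jj.
    apply; last by exists m.
    by have := Qtot i (s j); case: (boolP (Q i (s j))) => // Qi; case: nocof; exists j.
  exists m => // k Jk Rmk.
  (* Only [m] itself lies above [m] in [J], so [g m], being [h p] for some [p] above [m], equals
     [h m], which is [f i]. *)
  have -> : k = m by apply: anti; rewrite mmax.
  have [p [Jp Rmp] ->] := g_notin _ Jm.
  have -> : p = m by apply: anti; rewrite mmax.
  by rewrite hm; exact/fV/Qrefl.
exists (x |` g @` J).
  apply/spokesP; split; first by left.
  exists ((fun j => x |` g @` (J `&` [set k | R j k])) @` J); last first.
    apply: wo_chain_supset_image; first by move=> D _; exact: woR.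
    move=> a b _ _ Rab; apply: setUS; apply: image_subset => k [Jk Rbk].
    by split=> //; exact: trans Rbk.
  split.
    move=> _ [j Jj <-]; rewrite /within /=.
    (* The minimality of [J] ranges over all families in [A], so it applies to [g] as well as to
       [h]. *)
    have clj : ~ closure (g @` below j) x.
      by apply: minJ => // _ [k [Jk _] <-]; apply: gA; exists k.
    apply: filterS (nbhs_notin_closure clj) => y ny [->|[k Jk gk]].
      by left.
    right; exists k => //; split=> //=; apply/negPn/negP => njk.
    by apply: ny; exists k.
  move=> V xV; have [j Jj jV] := cvgg _ xV.
  exists (x |` g @` (J `&` [set k | R j k])); first by exists j.
  move=> y [_ [->|[k [Jk Rjk] <-]]]; first exact: nbhs_singleton.
  exact: jV.
move=> V xV; have [j Jj jV] := cvgg _ xV.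
have Rjj : R j j by have := tot j j; rewrite orbb.
exists (g j); split; last exact: jV.
by split; [right; exists j|apply: gA; exists j].
Qed.

Theorem corollary1p13 (X : topologicalType) (x : X) :
  radial_at x <->
  (forall C : set (set X), cofinal_spokes x C -> nbhs x (\bigcup_(S in C) S)).
Proof.
split=> [radx C [_ cofC]|cof A clA].
  apply: contrapT => nU; have clU : closure (~` \bigcup_(S in C) S) x.
    by rewrite closure_setC.
  have [S /cofC[D CD [V xV SVD]] clSU] := radial_spoke radx clU.
  have [y [[Sy nUy] Vy]] := clSU _ xV.
  by apply: nUy; exists D => //; apply: SVD.
rewrite -/(transfinite_cvg A x); apply: contrapT => nocvg.
(* A constant sequence would converge to [x] if [x] were in [A]. Hence [x] survives in [S] minus
   [A], which is then still a spoke. *)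
have nAx : ~ A x.
  move=> Ax; apply: nocvg; exists unit, (fun _ _ => true), (fun _ => x); split=> //.
    apply: wochoice.antisymmetric_well_order; first by move=> [] [].
    by move=> D [u Du]; exists u.
  by move=> V xV; exists tt => // u _; exact: nbhs_singleton.
have /cof/clA[y [Ay [S [_ SA] Sy]]] :
    cofinal_spokes x [set S | spokes x S /\ S `&` A = set0].
  split=> [S []|S spS] //; exists (S `\` A).
    split; last by rewrite setIC setDE setIC -setIA setICl setI0.
    have [Sx _] := (spokesP x S).1 spS.
    by apply: spokes_subset spS => //; exact: subDsetl.
  exists (~` (S `&` A)).
    by apply: nbhs_notin_closure => /(spoke_transfinite_cvg spS)/nocvg.
  by move=> y [Sy nSAy]; split=> // Ay; apply: nSAy.
by have : (S `&` A) y by []; rewrite SA.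
Qed.
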